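(* Let $X$ be a real Banach space. Then $X$ is fully Mackey complete if and only if the following condition holds: for every norming and norm-closed linear subspace $Y\subset X^*$ and every $x^*\in X^*\setminus Y$ there exists an absolutely convex $w^*$-compact set $K\subset X^*$ such that $K\subset Y\oplus[x^*]$ and $x^*\in\overline{K\cap Y}^{w^*}$.
   Context: $[x^*]$ denotes the linear span of $x^*$. A linear subspace $Y\subset X^*$ is norming if $|||x|||=\sup\{x^*(x): x^*\in Y,\ \|x^*\|\le 1\}$ defines an equivalent norm on $X$. For a $w^*$-dense subspace $Y\subset X^*$, $\mu(X,Y)$ is the Mackey topology on $X$: the locally convex topology of uniform convergence on absolutely convex $w^*$-compact subsets of $Y$. $X$ is fully Mackey complete if $(X,\mu(X,Y))$ is complete for every norming and norm-closed subspace $Y\subset X^*$. *)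

(* Defs.v *)
From HB Require Import structures.
From mathcomp Require Import all_boot all_order all_algebra.
From mathcomp Require Import all_classical all_reals all_analysis.
Set Implicit Arguments. Unset Strict Implicit. Unset Printing Implicit Defensive.
Import Order.TTheory GRing.Theory Num.Theory.
Import numFieldNormedType.Exports.
Local Open Scope classical_set_scope.
Local Open Scope ring_scope.

(* Real Banach space: X : completeNormedModType R with R : realType.
   The dual X^* is represented as the set of continuous linear functionals
   X -> R; the weak* topology is the pointwise topology {ptws X -> R}. *)

Section Dual.
Variables (R : realType) (X : normedModType R).

Definition dual : set (X -> R) :=
  [set f | (forall (a : R) (x y : X), f (a *: x + y) = a * f x + f y)
           /\ continuous f].

Definition dnorm (f : X -> R) : R := sup [set `|f x| | x in [set x : X | `|x| <= 1]].

Definition dsubspace (Y : set (X -> R)) : Prop :=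
  Y `<=` dual /\ Y (fun _ => 0) /\
  (forall f g, Y f -> Y g -> Y (fun x => f x + g x)) /\
  (forall (a : R) f, Y f -> Y (fun x => a * f x)).

Definition dnorm_closed (Y : set (X -> R)) : Prop :=
  forall f, dual f -> (forall e : R, 0 < e -> exists2 g, Y g & dnorm (fun x => f x - g x) < e) -> Y f.

Definition ynorm (Y : set (X -> R)) (x : X) : R :=
  sup [set f x | f in [set f | Y f /\ dnorm f <= 1]].

Definition norming (Y : set (X -> R)) : Prop :=
  exists c C : R, 0 < c /\ 0 < C /\
    forall x : X, c * `|x| <= ynorm Y x /\ ynorm Y x <= C * `|x|.

Definition abs_convex (K : set (X -> R)) : Prop :=
  forall f g (a b : R), K f -> K g -> `|a| + `|b| <= 1 ->
    K (fun x => a * f x + b * g x).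

Definition acwc (K : set (X -> R)) : Prop :=
  K `<=` dual /\ abs_convex K /\ compact (K : set {ptws X -> R}).

(* Mackey topology mu(X,Y), described by its uniformity: uniform convergence
   on absolutely convex w*-compact subsets of Y. *)
Definition mackey_cauchy (Y : set (X -> R)) (F : set_system X) : Prop :=
  forall K, acwc K -> K `<=` Y -> forall e : R, 0 < e ->
    exists2 A, F A & forall x y, A x -> A y -> forall f, K f -> `|f x - f y| < e.

Definition mackey_cvg (Y : set (X -> R)) (F : set_system X) (x0 : X) : Prop :=
  forall K, acwc K -> K `<=` Y -> forall e : R, 0 < e ->
    exists2 A, F A & forall x, A x -> forall f, K f -> `|f x - f x0| < e.

Definition mackey_complete (Y : set (X -> R)) : Prop :=
  forall F : set_system X, ProperFilter F -> mackey_cauchy Y F ->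
    exists x0, mackey_cvg Y F x0.

Definition fully_mackey_complete : Prop :=
  forall Y, dsubspace Y -> norming Y -> dnorm_closed Y -> mackey_complete Y.

End Dual.

(* Main.v *)
(* For the backward direction, a Mackey-Cauchy filter converges pointwise on [Y]
   to a functional [phi], which is norm bounded because it is bounded on the
   weak*-compact cubes spanned by null sequences of [Y]. Let [Z] be the kernel of
   [phi] in [Y]. If [Z] is norming, the condition applied to [Z] and some [xs] in
   [Y] with [phi xs = 1] contradicts the continuity of [phi] on [K]. If it is not,
   [phi] is a norm limit of evaluations on [Y], hence an evaluation.

   For the forward direction, the functional [g + t xs |-> t] on [Y + [xs]] is not
   an evaluation, so by completeness it is not a uniform limit of evaluations on
   every absolutely convex weak*-compact [K]. By separation some [K `&` Y] is then
   not weak*-closed, and a point [y + t xs] of its closure outside [Y] is moved to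
   [xs] by replacing [K] with [t^-1 (K + [-1, 1] y)]. *)
Require Import Defs.
From HB Require Import structures.
From mathcomp Require Import all_boot all_order all_algebra.
From mathcomp Require Import all_classical all_reals all_analysis.
From mathcomp Require Import ring lra.
Import Order.TTheory GRing.Theory Num.Theory.
Import numFieldNormedType.Exports.
Local Open Scope classical_set_scope.
Local Open Scope ring_scope.

(** * The dual space, its norm, and norming subspaces *)

Section DualSpace.
Context {R : realType} {X : normedModType R}.
Implicit Types (f g h : X -> R) (x y : X) (K Y : set (X -> R)).

Lemma dual_lin f (a : R) x y : dual f -> f (a *: x + y) = a * f x + f y.
Proof. by case. Qed.

Lemma dualZ f (a : R) x : dual f -> f (a *: x) = a * f x.
Proof.
move=> df; have f0 : f 0 = 0.
  have := dual_lin f 1 0 0 df; rewrite scale1r addr0 mul1r => /eqP.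
  by rewrite -subr_eq subrr => /eqP <-.
by have := dual_lin f a x 0 df; rewrite addr0 f0 addr0.
Qed.

Lemma dualD f x y : dual f -> f (x + y) = f x + f y.
Proof. by move=> df; have := dual_lin f 1 x y df; rewrite scale1r mul1r. Qed.

Lemma dualB f x y : dual f -> f (x - y) = f x - f y.
Proof. by move=> df; rewrite -scaleN1r dualD// dualZ// mulN1r. Qed.

Lemma dual0P f : dual f -> f 0 = 0.
Proof. by move=> df; rewrite -(scale0r 0) dualZ// mul0r. Qed.

Lemma dual_sum f (I : Type) (r : seq I) (c : I -> R) (v : I -> X) :
  dual f -> f (\sum_(i <- r) c i *: v i) = \sum_(i <- r) c i * f (v i).
Proof.
move=> df; elim: r => [|i r IH]; first by rewrite !big_nil dual0P.
by rewrite !big_cons dual_lin// IH.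
Qed.

Lemma bounded_dual f (M : R) :
  (forall (a : R) x y, f (a *: x + y) = a * f x + f y) ->
  (forall x, `|f x| <= M * `|x|) -> dual f.
Proof.
move=> fl fM; split=> // x; apply/cvgrPdist_lt => e e0.
near=> y.
have -> : f x - f y = f (x - y).
  by have := fl (-1) y x; rewrite scaleN1r addrC => ->; rewrite mulN1r addrC.
(* [M] carries no sign, so the positive [|M| + 1] is used as the Lipschitz constant. *)
have M0 : 0 < `|M| + 1 by rewrite ltr_wpDl.
apply: (@le_lt_trans _ _ ((`|M| + 1) * `|x - y|)).
  apply: le_trans (fM _) _; rewrite ler_wpM2r// (le_trans (ler_norm _))// lerDl//.
rewrite mulrC -ltr_pdivlMr//.
near: y; apply: cvgr_dist_lt => //; exact: divr_gt0.
Unshelve. all: by end_near. Qed.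

Lemma dual_norm_ubound f :
  dual f -> exists2 M : R, 0 <= M & forall x, `|f x| <= M * `|x|.
Proof.
move=> df; have [fl fc] := df.
have /cvgrPdist_lt/(_ 1 ltr01) := fc 0.
rewrite dual0P// => /nbhs_ballP[d /= d0 dP].
(* [|f| < 1] on the ball of radius [d], and every nonzero [x] is rescaled to norm [d / 2]. *)
exists (2 / d); first by rewrite divr_ge0// ltW.
move=> x; have [->|x0] := eqVneq x 0; first by rewrite dual0P// !normr0 mulr0.
have nx : 0 < `|x| by rewrite normr_gt0.
pose c := d / 2 / `|x|.
have c0 : 0 < c by rewrite !divr_gt0.
have /dP : ball 0 d (c *: x).
  rewrite -ball_normE /= sub0r normrN normrZ gtr0_norm// /c divfK ?gt_eqF//.
  by rewrite ltr_pdivrMr// ltr_pMr// ltrDl.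
rewrite /= sub0r normrN dualZ// normrM gtr0_norm// => h.
rewrite -(ler_pM2l c0) (le_trans (ltW h))// /c.
have -> : d / 2 / `|x| * (2 / d * `|x|) = 1 by field; rewrite !gt_eqF.
by [].
Qed.

Let dnorm_set f := [set `|f x| | x in [set x : X | `|x| <= 1]].

Lemma dnorm_has_sup f : dual f -> has_sup (dnorm_set f).
Proof.
move=> df; have [M M0 fM] := dual_norm_ubound f df; split.
  by exists `|f 0|, 0 => //=; rewrite normr0.
exists M => _ [x /= x1 <-]; apply: le_trans (fM _) _.
by rewrite -[leRHS]mulr1 ler_wpM2l.
Qed.

Lemma le_dnorm f x : dual f -> `|f x| <= dnorm f * `|x|.
Proof.
move=> df; have [->|x0] := eqVneq x 0; first by rewrite dual0P// !normr0 mulr0.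
have nx : 0 < `|x| by rewrite normr_gt0.
rewrite -ler_pdivrMr//.
apply: (sup_upper_bound (dnorm_has_sup f df)); exists (`|x|^-1 *: x) => /=.
  by rewrite normrZ ger0_norm ?invr_ge0// mulVf// gt_eqF.
by rewrite dualZ// normrM ger0_norm ?invr_ge0// mulrC.
Qed.

Lemma dnorm_le f (M : R) :
  0 <= M -> (forall x, `|f x| <= M * `|x|) -> dnorm f <= M.
Proof.
move=> M0 fM; apply: ge_sup; first by exists `|f 0|, 0 => //=; rewrite normr0.
move=> _ [x /= x1 <-]; apply: le_trans (fM _) _.
by rewrite -[leRHS]mulr1 ler_wpM2l.
Qed.

Lemma dnorm_ge0 f : dual f -> 0 <= dnorm f.
Proof.
move=> df; apply: le_trans (normr_ge0 (f 0)) _.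
by apply: (sup_upper_bound (dnorm_has_sup f df)); exists 0; rewrite //= normr0.
Qed.

Lemma dual_comb f g (a b : R) :
  dual f -> dual g -> dual (fun x => a * f x + b * g x).
Proof.
move=> df dg; have [M _ fM] := dual_norm_ubound f df.
have [N _ gN] := dual_norm_ubound g dg.
apply: (@bounded_dual _ (`|a| * M + `|b| * N)) => [c x y|x].
  by rewrite !dual_lin//; ring.
rewrite (le_trans (ler_normD _ _))// !normrM mulrDl -!mulrA.
by rewrite lerD// ler_wpM2l.
Qed.

Lemma dualB_fun f g : dual f -> dual g -> dual (fun x => f x - g x).
Proof.
move=> df dg; have := dual_comb f g 1 (-1) df dg.
by under eq_fun do rewrite mul1r mulN1r.
Qed.

Lemma dnorm_dist f g x : dual f -> dual g ->
  `|f x - g x| <= dnorm (fun x => f x - g x) * `|x|.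
Proof. by move=> df dg; exact: (le_dnorm _ x (dualB_fun f g df dg)). Qed.

Lemma dsubspace_dual Y f : dsubspace Y -> Y f -> dual f.
Proof. by case=> + _; exact. Qed.

Lemma dsubspace0 Y : dsubspace Y -> Y (fun=> 0).
Proof. by case=> _ []. Qed.

Lemma dsubspace_comb Y f g (a b : R) : dsubspace Y -> Y f -> Y g ->
  Y (fun x => a * f x + b * g x).
Proof. by move=> [_ [_ [YD YZ]]] Yf Yg; apply: YD; exact: YZ. Qed.

Lemma dsubspaceZ Y f (a : R) : dsubspace Y -> Y f -> Y (fun x => a * f x).
Proof. by move=> [_ [_ [_ YZ]]]; exact: YZ. Qed.

Lemma dsubspaceDZ Y f g (a : R) : dsubspace Y -> Y f -> Y g ->
  Y (fun x => f x + a * g x).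
Proof. by move=> [_ [_ [YD YZ]]] Yf Yg; apply: YD => //; exact: YZ. Qed.

Lemma ynorm_has_sup Y x : dsubspace Y ->
  has_sup [set f x | f in [set f | Y f /\ dnorm f <= 1]].
Proof.
move=> sY; split.
  exists 0, (fun=> 0) => //=; split; first exact: dsubspace0.
  by apply: dnorm_le => // y; rewrite normr0 mul1r.
exists `|x| => _ [f /= [Yf f1] <-]; apply: le_trans (ler_norm _) _.
apply: le_trans (le_dnorm f x (dsubspace_dual Y f sY Yf)) _.
by rewrite -[leRHS]mul1r ler_wpM2r.
Qed.

Lemma le_ynorm Y f x : dsubspace Y -> Y f -> `|f x| <= ynorm Y x * dnorm f.
Proof.
move=> sY Yf; have df := dsubspace_dual Y f sY Yf.
have [f0|f0] := eqVneq (dnorm f) 0.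
  by rewrite f0 mulr0; have := le_dnorm f x df; rewrite f0 mul0r.
have nf : 0 < dnorm f by rewrite lt_neqAle eq_sym f0 dnorm_ge0.
(* [ynorm] takes the supremum of [f x] without absolute value, so the normalized functional is
   tested with both signs. *)
have key (s : R) : `|s| = 1 -> s * f x <= ynorm Y x * dnorm f.
  move=> s1; rewrite -ler_pdivrMr//.
  apply: (sup_upper_bound (ynorm_has_sup Y x sY)).
  exists (fun x => s / dnorm f * f x); last by rewrite mulrAC.
  split; first exact: dsubspaceZ.
  apply: dnorm_le => // y; rewrite !normrM s1 !mul1r.
  rewrite ger0_norm ?invr_ge0 ?dnorm_ge0// mulrC ler_pdivrMr// [leRHS]mulrC.
  exact: le_dnorm.
rewrite ler_norml; apply/andP; split.
  by rewrite lerNl -mulN1r; apply: key; rewrite normrN normr1.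
by rewrite -[f x]mul1r; apply: key; rewrite normr1.
Qed.

Lemma ynorm_ge0 Y x : dsubspace Y -> 0 <= ynorm Y x.
Proof.
move=> sY; apply: (sup_upper_bound (ynorm_has_sup Y x sY)); exists (fun=> 0) => //=.
split; first exact: dsubspace0.
by apply: dnorm_le => // y; rewrite normr0 mul1r.
Qed.

Lemma ynorm_le Y x (M : R) : dsubspace Y ->
  (forall f, Y f -> dnorm f <= 1 -> f x <= M) -> ynorm Y x <= M.
Proof.
move=> sY YM; apply: ge_sup; first by case: (ynorm_has_sup Y x sY).
by move=> _ [f /= [Yf f1] <-]; exact: YM.
Qed.

Lemma ynorm_le_norm Y x : dsubspace Y -> ynorm Y x <= `|x|.
Proof.
move=> sY; apply: ynorm_le => // f Yf f1; apply: le_trans (ler_norm _) _.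
apply: le_trans (le_dnorm f x (dsubspace_dual Y f sY Yf)) _.
by rewrite -[leRHS]mul1r ler_wpM2r.
Qed.

Lemma ynorm_adherent Y x (M : R) : dsubspace Y -> M < ynorm Y x ->
  exists f, [/\ Y f, dnorm f <= 1 & M < f x].
Proof.
move=> sY /(sup_gt (proj1 (ynorm_has_sup Y x sY)))[_ [f [Yf f1] <-] Mf].
by exists f.
Qed.

(** The upper estimate always holds with constant 1, since the functionals in the supremum have norm
    at most 1. *)
Lemma normingI Y (c : R) : dsubspace Y -> 0 < c ->
  (forall x, c * `|x| <= ynorm Y x) -> norming Y.
Proof.
move=> sY c0 cY; exists c, 1; split=> //; split=> // x.
by rewrite mul1r; split; [exact: cY|exact: ynorm_le_norm].
Qed.

Lemma norming_sub Y Z : dsubspace Z -> norming Y -> dsubspace Y -> Y `<=` Z ->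
  norming Z.
Proof.
move=> sZ [c [C [c0 [_ cY]]]] sY YZ; apply: (normingI _ c) => // x.
apply: le_trans (proj1 (cY x)) _; apply: ynorm_le => // f Yf f1.
apply: (sup_upper_bound (ynorm_has_sup Z x sZ)); exists f => //.
by split => //; exact: YZ.
Qed.

Lemma norming_eq0 Y x : dsubspace Y -> norming Y ->
  (forall f, Y f -> f x = 0) -> x = 0.
Proof.
move=> sY [c [C [c0 [_ cY]]]] Yx; apply/normr0_eq0/eqP.
rewrite eq_le normr_ge0 andbT -(ler_pM2l c0) mulr0.
apply: le_trans (proj1 (cY x)) _.
by apply: ynorm_le => // f Yf _; rewrite Yx.
Qed.

End DualSpace.

(** * The weak* topology and absolutely convex weak*-compact sets *)

Section PointwiseTopology.
Context {R : realType} {X : normedModType R}.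
Implicit Types (f g h : X -> R) (x y : X) (K Y : set (X -> R)).

Lemma ptws_continuous (T : topologicalType) (h : T -> {ptws X -> R}) :
  (forall x, continuous (fun t => h t x)) -> continuous h.
Proof. by move=> hc t; apply/pointwise_cvgP => x; exact: hc. Qed.

Lemma continuous_addf (T : topologicalType) (u v : T -> R) :
  continuous u -> continuous v -> continuous (fun t => u t + v t).
Proof. by move=> uc vc t; exact: (cvgD (uc t) (vc t)). Qed.

Lemma continuous_mulf (T : topologicalType) (u v : T -> R) :
  continuous u -> continuous v -> continuous (fun t => u t * v t).
Proof. by move=> uc vc t; exact: (cvgM (uc t) (vc t)). Qed.

Lemma continuous_mulr (T : topologicalType) (u : T -> R) (a : R) :
  continuous u -> continuous (fun t => u t * a).
Proof. by move=> uc; apply: continuous_mulf => //; exact: cst_continuous. Qed.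

Lemma continuous_comb (T : topologicalType) (u v : T -> R) (a b : R) :
  continuous u -> continuous v -> continuous (fun t => a * u t + b * v t).
Proof.
by move=> uc vc; apply: continuous_addf; apply: continuous_mulf => //;
  exact: cst_continuous.
Qed.

Lemma closed_norm_le (T : topologicalType) (u : T -> R) (a : R) :
  continuous u -> closed [set t | `|u t| <= a].
Proof.
move=> uc; apply: (@closed_comp _ _ (fun t => `|u t|) [set r | r <= a]).
  by move=> t _; apply: cvg_norm; exact: uc.
exact: closed_le.
Qed.

Lemma continuous_sumr (T : topologicalType) (I : Type) (r : seq I)
    (u : I -> T -> R) :
  (forall i, continuous (u i)) -> continuous (fun t => \sum_(i <- r) u i t).
Proof.
move=> uc; elim: r => [|i r IH] t.
  by under eq_fun do rewrite big_nil; exact: cvg_cst.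
under eq_fun do rewrite big_cons.
exact: (cvgD (uc i t) (IH t)).
Qed.

Lemma half_exp_small (C e : R) : 0 < e -> exists N, C * 2^-1 ^+ N < e.
Proof.
move=> e0.
have : (C * 2^-1 ^+ n) @[n --> \oo] --> C * (0 : R).
  apply: cvgMl_tmp; apply: cvg_expr.
  by rewrite ger0_norm ?invr_ge0// invf_lt1// ltr1n.
rewrite mulr0 => /cvgrPdist_lt/(_ e e0)[N _ /(_ N (leqnn N))] /=.
by rewrite sub0r normrN => h; exists N; apply: le_lt_trans h; exact: ler_norm.
Qed.

Lemma half_exp_eq0 (C d : R) : (forall N, `|d| <= C * 2^-1 ^+ N) -> d = 0.
Proof.
move=> dC; apply/normr0_eq0/eqP; rewrite eq_le normr_ge0 andbT leNgt.
apply/negP => d0; have [N] := half_exp_small C `|d| d0.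
by rewrite ltNge dC.
Qed.

Lemma eval_continuous (I : eqType) (i : I) :
  continuous (fun f : {ptws I -> R} => f i).
Proof. exact: (@proj_continuous I (fun=> R) i). Qed.

Lemma eval_fst_continuous (I : eqType) (T : topologicalType) (i : I) :
  continuous (fun p : {ptws I -> R} * T => p.1 i).
Proof.
move=> p.
apply: (@cvg_comp _ _ _ fst (fun f : {ptws I -> R} => f i) _ (nbhs p.1)).
  exact: cvg_fst.
exact: eval_continuous.
Qed.

Lemma eval_snd_continuous (I : eqType) (T : topologicalType) (i : I) :
  continuous (fun p : T * {ptws I -> R} => p.2 i).
Proof.
move=> p.
apply: (@cvg_comp _ _ _ snd (fun f : {ptws I -> R} => f i) _ (nbhs p.2)).
  exact: cvg_snd.
exact: eval_continuous.
Qed.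

Lemma acwc_closed K : acwc K -> closed (K : set {ptws X -> R}).
Proof.
move=> [_ [_]]; apply: compact_closed.
exact: (@hausdorff_product X (fun=> R) (fun=> @Rhausdorff R)).
Qed.

Lemma abs_convex0 K f : abs_convex K -> K f -> K (fun=> 0).
Proof.
move=> cK Kf; have := cK f f 0 0 Kf Kf; rewrite normr0 addr0 ler01 => /(_ isT).
by under eq_fun do rewrite mul0r addr0.
Qed.

Lemma abs_convexZ K f (a : R) : abs_convex K -> K f -> `|a| <= 1 ->
  K (fun x => a * f x).
Proof.
move=> cK Kf a1; have := cK f f a 0 Kf Kf; rewrite normr0 addr0 => /(_ a1).
by under eq_fun do rewrite mul0r addr0.
Qed.

(** Compactness passes to the continuous image of a product. Such combinations serve to enlarge a
    compact set by a segment and to put two compact sets inside a common one. *)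
Lemma acwc_comb K L (a b : R) : acwc K -> acwc L ->
  acwc [set h | exists f g, [/\ K f, L g & h = (fun x => a * f x + b * g x)]].
Proof.
move=> [Kd [Kc Kk]] [Ld [Lc Lk]]; split; last split.
- move=> _ [f [g [Kf Lg ->]]]; apply: dual_comb; [exact: Kd|exact: Ld].
- move=> _ _ c d [f [g [Kf Lg ->]]] [f' [g' [Kf' Lg' ->]]] cd.
  exists (fun x => c * f x + d * f' x), (fun x => c * g x + d * g' x).
  by split; [exact: Kc|exact: Lc|apply/funext => x; ring].
- pose s (p : {ptws X -> R} * {ptws X -> R}) : {ptws X -> R} :=
    fun x => a * p.1 x + b * p.2 x.
  suff -> : [set h | exists f g, [/\ K f, L g & h = (fun x => a * f x + b * g x)]]
      = s @` ((K : set {ptws X -> R}) `*` (L : set {ptws X -> R})).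
    apply: continuous_compact; last exact: compact_setX.
    apply: continuous_subspaceT; apply: ptws_continuous => x.
    apply: continuous_comb; first exact: eval_fst_continuous.
    exact: eval_snd_continuous.
  apply/seteqP; split=> [_ [f [g [Kf Lg ->]]]|_ [[f g] [/= Kf Lg] <-]].
    by exists (f, g).
  by exists f, g.
Qed.

(** Uniform convergence on this segment amounts to convergence at the single functional [f]. *)
Lemma acwc_segment f : dual f ->
  acwc [set g | exists2 t : R, `|t| <= 1 & g = (fun x => t * f x)].
Proof.
move=> df; split; last split.
- move=> _ [t _ ->]; have := dual_comb f f t 0 df df.
  by under eq_fun do rewrite mul0r addr0.
- move=> _ _ a b [s s1 ->] [t t1 ->] ab; exists (a * s + b * t).
    rewrite (le_trans (ler_normD _ _))// !normrM (le_trans _ ab)//.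
    by rewrite lerD// -[leRHS]mulr1 ler_wpM2l.
  by apply/funext => x; ring.
- pose m (t : R) : {ptws X -> R} := fun x => t * f x.
  suff -> : [set g | exists2 t : R, `|t| <= 1 & g = (fun x => t * f x)]
      = m @` `[(-1), 1]%classic.
    apply: continuous_compact; last exact: segment_compact.
    apply: continuous_subspaceT; apply: ptws_continuous => x t.
    by apply: cvgMr_tmp; exact: cvg_id.
  apply/seteqP; split=> [_ [t t1 ->]|_ [t t1 <-]].
    by exists t => //=; rewrite in_itv /= -ler_norml.
  by exists t => //; move: t1; rewrite /= in_itv /= -ler_norml.
Qed.


(* Witnessing the sums by their partial sums makes the convergence of the
   series superfluous. *)
Definition cube (u : nat -> X -> R) : set (X -> R) :=
  [set f | exists a : nat -> R, (forall n, `|a n| <= 1) /\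
    forall N x, `|f x - \sum_(i < N) a i * u i x| <= 2 * `|x| * 2^-1 ^+ N].

(** The cube is the projection of a closed set of pairs (coefficients, functional) inside a
    Tychonoff product of intervals. Linearity and absolute convexity are inherited from the partial
    sums. *)
Lemma acwc_cube (u : nat -> X -> R) :
  (forall n, dual (u n)) ->
  acwc (cube u).
Proof.
move=> du.
have half_gt0 n : 0 < 2^-1 ^+ n :> R by rewrite exprn_gt0// invr_gt0.
split; last split.
- move=> f [a [a1 fa]]; apply: (@bounded_dual _ _ _ 2) => [c x y|x]; last first.
    by have := fa 0 x; rewrite big_ord0 subr0 expr0 mulr1.
  apply/eqP; rewrite -subr_eq0; apply/eqP.
  apply: (half_exp_eq0 (2 * (`|c *: x + y| + `|c| * `|x| + `|y|))) => N.
  have := fa N (c *: x + y).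
  have -> : \sum_(i < N) a i * u i (c *: x + y) =
      c * (\sum_(i < N) a i * u i x) + \sum_(i < N) a i * u i y.
    rewrite mulr_sumr -big_split /=; apply: eq_bigr => i _.
    by rewrite dual_lin//; ring.
  have := fa N x; have := fa N y.
  set S := \sum_(i < N) _; set S' := \sum_(i < N) _ => fy fx fxy.
  have -> : f (c *: x + y) - (c * f x + f y) =
     (f (c *: x + y) - (c * S' + S)) - (c * (f x - S') + (f y - S)) by ring.
  apply: le_trans (ler_normB _ _) _.
  apply: le_trans (lerD fxy (ler_normD _ _)) _; rewrite normrM.
  have := ler_wpM2l (normr_ge0 c) fx; lra.
- move=> f g c d [a [a1 fa]] [b [b1 gb]] cd.
  exists (fun n => c * a n + d * b n); split=> [n|N x].
    rewrite (le_trans (ler_normD _ _))// !normrM (le_trans _ cd)//.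
    by rewrite lerD// -[leRHS]mulr1 ler_wpM2l.
  have -> : \sum_(i < N) (c * a i + d * b i) * u i x =
      c * (\sum_(i < N) a i * u i x) + d * (\sum_(i < N) b i * u i x).
    rewrite !mulr_sumr -big_split /=; apply: eq_bigr => i _; ring.
  have := fa N x; have := gb N x.
  set S := \sum_(i < N) _; set S' := \sum_(i < N) _ => gx fx.
  have -> : c * f x + d * g x - (c * S' + d * S) =
    c * (f x - S') + d * (g x - S) by ring.
  rewrite (le_trans (ler_normD _ _))// !normrM.
  set T := 2 * _ * _ in gx fx *.
  have T0 : 0 <= T by rewrite !mulr_ge0// ltW.
  apply: (@le_trans _ _ ((`|c| + `|d|) * T)).
    by rewrite mulrDl lerD// ler_wpM2l.
  by rewrite -[leRHS]mul1r ler_wpM2r.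
- pose A := [set a : {ptws nat -> R} | forall n, `[(-1), 1]%classic (a n)].
  (* These intervals come from the estimate with the empty partial sum, [N = 0]. *)
  pose B := [set f : {ptws X -> R} |
    forall x, `[(- (2 * `|x|)), (2 * `|x|)]%classic (f x)].
  pose D := \bigcap_(N in [set: nat]) \bigcap_(x in [set: X])
    [set p : {ptws nat -> R} * {ptws X -> R} |
      `|p.2 x - \sum_(i < N) p.1 i * u i x| <= 2 * `|x| * 2^-1 ^+ N].
  have -> : cube u = snd @` ((A `*` B) `&` D).
    apply/seteqP; split=> [f [a [a1 fa]]|_ [[a f] [[/= aA fB] aD] <-]].
      exists (a, f) => //; split; last by move=> N _ x _; exact: fa.
      split=> [n|x]; rewrite /= in_itv /= -ler_norml; first exact: a1.
      by have := fa 0 x; rewrite big_ord0 subr0 expr0 mulr1.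
    exists a; split=> [n|N x]; last exact: (aD N I x I).
    by have := aA n; rewrite /= in_itv /= -ler_norml.
  apply: continuous_compact; first by apply: continuous_subspaceT => p; exact: cvg_snd.
  apply: compact_closedI.
    apply: compact_setX.
      apply: (@tychonoff nat (fun=> R) (fun=> `[(-1), 1]%classic)) => n.
      exact: segment_compact.
    apply: (@tychonoff X (fun=> R)
      (fun x => `[(- (2 * `|x|)), (2 * `|x|)]%classic)) => x.
    exact: segment_compact.
  apply: closed_bigI => N _; apply: closed_bigI => x _.
  pose e (p : {ptws nat -> R} * {ptws X -> R}) : R :=
    p.2 x - \sum_(i < N) p.1 i * u i x.
  apply: (closed_norm_le _ e).
  have -> : e = (fun p => 1 * p.2 x + (-1) * \sum_(i < N) p.1 i * u i x).
    by apply/funext => p; rewrite mul1r mulN1r.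
  apply: continuous_comb; first exact: eval_snd_continuous.
  apply: continuous_sumr => i; apply: continuous_mulr.
  exact: eval_fst_continuous.
Qed.

(** The partial sums lie in [Y] and approximate [f] in norm with error at most [2 * 2^-N]. *)
Lemma cube_sub Y (u : nat -> X -> R) : dsubspace Y -> dnorm_closed Y ->
  (forall n, Y (u n)) ->
  cube u `<=` Y.
Proof.
move=> sY cY uY f fK.
have df : dual f.
  by apply: (proj1 (acwc_cube u _) f fK) => n; exact: dsubspace_dual sY (uY n).
case: fK => a [_ fa]; apply: cY => // e e0.
have [N Ne] := half_exp_small 2 e e0.
exists (fun x => \sum_(i < N) a i * u i x); last first.
  apply: le_lt_trans Ne; apply: dnorm_le => [|x].
    by rewrite mulr_ge0// exprn_ge0// invr_ge0.
  by apply: le_trans (fa N x) _; rewrite mulrAC.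
elim: N {Ne} => [|N IH].
  by under eq_fun do rewrite big_ord0; exact: dsubspace0.
by under eq_fun do rewrite big_ord_recr /=; exact: dsubspaceDZ.
Qed.

Lemma mem_cube (u : nat -> X -> R) n :
  (forall n, dual (u n)) -> (forall n, dnorm (u n) <= 2^-1 ^+ n) ->
  cube u (u n).
Proof.
(* With the n-th unit vector as coefficients, the partial sum is [u n] when [n < N]. Otherwise it is
   0 and the error is [u n] itself, of norm at most [2^-n <= 2^-N]. *)
move=> du u1; exists (fun i => (i == n)%:R); split=> [i|N x].
  by rewrite normr_nat lern1 leq_b1.
have half_ge0 k : 0 <= 2^-1 ^+ k :> R by rewrite exprn_ge0// invr_ge0.
have [nN|Nn] := ltnP n N.
  rewrite (bigD1 (Ordinal nN))//= eqxx mul1r big1 ?addr0 ?subrr ?normr0.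
    by rewrite !mulr_ge0.
  move=> i /eqP ni; case: eqP => [ein|]; last by rewrite mul0r.
  by case: ni; exact: val_inj.
rewrite big1 ?subr0 => [|i _]; last first.
  by case: eqP => [ein|]; [have := ltn_ord i; rewrite ein ltnNge Nn|rewrite mul0r].
apply: le_trans (le_dnorm _ _ (du n)) _; rewrite mulrC -mulrA mulrCA.
rewrite ler_wpM2l//; apply: le_trans (u1 n) _.
apply: le_trans (_ : 2^-1 ^+ N <= _); last by rewrite ler_peMl// ler1n.
by rewrite ler_wiXn2l// ?invr_ge0// invf_le1// ler1n.
Qed.

End PointwiseTopology.

(** * The limit functional of a Mackey-Cauchy filter *)

Section LimitFunctional.
Context {R : realType} {X : normedModType R}.
Implicit Types (f g h : X -> R) (x y : X) (K Y : set (X -> R)).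

Lemma mackey_limit Y (F : set_system X) : dsubspace Y -> ProperFilter F ->
  mackey_cauchy Y F -> exists phi : (X -> R) -> R,
  (forall f g a b, Y f -> Y g ->
    phi (fun x => a * f x + b * g x) = a * phi f + b * phi g) /\
  (forall K, acwc K -> K `<=` Y -> forall e : R, 0 < e ->
    exists2 A, F A & forall x, A x -> forall f, K f -> `|f x - phi f| <= e).
Proof.
(* Convergence is only known for [f] in [Y]; elsewhere [lim] may be a default value, and nothing is
   claimed there. *)
move=> sY FF cF; pose phi f : R := lim (f x @[x --> F]).
have phiP f : Y f -> f x @[x --> F] --> phi f.
  move=> Yf; apply: cauchy_cvg; apply/cauchy_ballP => e e0.
  have df := dsubspace_dual Y f sY Yf.
  have [|A FA Ae] := cF _ (acwc_segment f df) _ e e0.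
    by move=> _ [t _ ->]; exact: dsubspaceZ.
  have FfA : F (f @^-1` (f @` A)) by apply: filterS FA => z Az; exists z.
  exists (f @` A, f @` A) => /=; last first.
    move=> [_ _] [/= [x Ax <-] [y Ay <-]]; rewrite -ball_normE /=.
    by apply: Ae => //; exists 1; [rewrite normr1|apply/funext => z; rewrite mul1r].
  by split.
exists phi; split=> [f g a b Yf Yg|K aK KY e e0].
  have fl : a * f x @[x --> F] --> a * phi f by exact: cvgMl_tmp (phiP f Yf).
  have gl : b * g x @[x --> F] --> b * phi g by exact: cvgMl_tmp (phiP g Yg).
  by apply/cvg_lim => //; exact: (cvgD fl gl).
have [A FA Ae] := cF K aK KY e e0; exists A => // x Ax f Kf.
apply/ler_addgt0Pr => d d0.
have /cvgrPdist_lt/(_ d d0) fd := phiP f (KY f Kf).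
(* The Cauchy estimate compares [x] with a [y] in [A] at which [f y] is already within [d] of
   [phi f]; [A] does not depend on [f]. *)
have [y [Ay fy]] := filter_ex (filterI FA fd).
have -> : f x - phi f = (f x - f y) - (phi f - f y) by ring.
apply: le_trans (ler_normB _ _) _; apply: lerD; last exact: ltW.
by apply: ltW; exact: Ae.
Qed.

(** If [phi] were unbounded, [Y] would contain a sequence [u] with [dnorm (u n) <= 2^-n] and
    [|phi (u n)| > n]. Its cube is an admissible compact subset of [Y], so on it [phi] is within 1
    of evaluation at a single [y], which bounds all [phi (u n)]. *)
Lemma mackey_limit_bounded Y (F : set_system X) (phi : (X -> R) -> R) :
  dsubspace Y -> dnorm_closed Y -> ProperFilter F ->
  (forall f g a b, Y f -> Y g ->
    phi (fun x => a * f x + b * g x) = a * phi f + b * phi g) ->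
  (forall K, acwc K -> K `<=` Y -> forall e : R, 0 < e ->
    exists2 A, F A & forall x, A x -> forall f, K f -> `|f x - phi f| <= e) ->
  exists2 M : R, 0 <= M & forall f, Y f -> `|phi f| <= M * dnorm f.
Proof.
move=> sY cY FF philin phiF.
have phiZ a f : Y f -> phi (fun x => a * f x) = a * phi f.
  move=> Yf; have := philin f f a 0 Yf Yf; rewrite mul0r addr0 => <-.
  by congr phi; apply/funext => x; rewrite mul0r addr0.
apply: contrapT => nM.
have unb n : exists u, [/\ Y u, dnorm u <= 2^-1 ^+ n & n%:R < `|phi u|].
  have h0 : 0 < 2^-1 ^+ n :> R by rewrite exprn_gt0// invr_gt0.
  apply: contrapT => nu; apply: nM.
  exists (n%:R / 2^-1 ^+ n) => [|f Yf]; first by rewrite divr_ge0// ltW.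
  have df := dsubspace_dual Y f sY Yf.
  have [f0|fn0] := eqVneq (dnorm f) 0.
    have fE : f = (fun x => 0 * f x).
      apply/funext => x; rewrite mul0r; apply/normr0_eq0/eqP.
      by rewrite eq_le normr_ge0 andbT -(mul0r `|x|) -f0 le_dnorm.
    by rewrite f0 mulr0 fE phiZ// mul0r normr0.
  have fp : 0 < dnorm f by rewrite lt_neqAle eq_sym fn0 dnorm_ge0.
  rewrite leNgt; apply/negP => lt; apply: nu.
  (* Rescaling [f] to norm [2^-n] turns the failure of the bound [n / 2^-n] into a value above
     [n]. *)
  exists (fun x => (2^-1 ^+ n / dnorm f) * f x); split.
  - exact: dsubspaceZ.
  - apply: dnorm_le => [|x]; first exact: ltW.
    rewrite normrM gtr0_norm ?divr_gt0// -mulrA ler_wpM2l ?(ltW h0)//.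
    by rewrite ler_pdivrMl// le_dnorm.
  - rewrite phiZ// normrM gtr0_norm ?divr_gt0//.
    by rewrite mulrAC ltr_pdivlMr// [ltRHS]mulrC -ltr_pdivrMr// mulrAC.
have [u uP] := choice unb.
have du n : dual (u n) by apply: (dsubspace_dual Y) => //; case: (uP n).
have uY n : Y (u n) by case: (uP n).
have [A FA Ae] := phiF _ (acwc_cube u du) (cube_sub Y u sY cY uY) 1 ltr01.
have [y Ay] := filter_ex FA.
have bnd n : n%:R < 1 + 2 * `|y|.
  have [_ _ /lt_le_trans] := uP n; apply.
  have un : cube u (u n) by apply: mem_cube => // m; case: (uP m).
  have := Ae y Ay (u n) un; case: un => a [_ /(_ 0 y)].
  rewrite big_ord0 subr0 expr0 mulr1 => uy h.
  have -> : phi (u n) = u n y - (u n y - phi (u n)) by ring.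
  by apply: le_trans (ler_normB _ _) _; rewrite addrC lerD.
have y0 : 0 <= 1 + 2 * `|y| by rewrite addr_ge0// mulr_ge0.
by have := archi_boundP y0; rewrite ltNge ltW.
Qed.

End LimitFunctional.

(** * Norm limits of evaluations and the case of a kernel that is not norming *)

Section KernelNorming.
Context {R : realType} {X : completeNormedModType R}.
Implicit Types (f g h : X -> R) (x y : X) (K Y : set (X -> R)).

(** Points representing [phi] up to small errors are close in [ynorm Y], hence in norm because [Y]
    is norming; completeness of [X] supplies their limit. *)
Lemma approx_eval Y (phi : (X -> R) -> R) : dsubspace Y -> norming Y ->
  (forall e : R, 0 < e -> exists w, forall f, Y f ->
    `|f w - phi f| <= e * dnorm f) ->
  exists x0, forall f, Y f -> f x0 = phi f.
Proof.
move=> sY [c [C [c0 [_ cY]]]] approx.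
pose B (e : R) := [set w | forall f, Y f -> `|f w - phi f| <= e * dnorm f].
pose G := filter_from [set e : R | 0 < e] B.
have PG : ProperFilter G.
  apply: filter_from_proper; last by move=> e /approx.
  apply: filter_from_filter; first by exists 1; exact: ltr01.
  move=> d e d0 e0; exists (Num.min d e); first by rewrite /= lt_min d0 e0.
  move=> w Bw; split=> f Yf; apply: le_trans (Bw f Yf) _;
    rewrite ler_wpM2r ?ge_min ?lexx ?orbT//; exact: dnorm_ge0 (dsubspace_dual Y f sY Yf).
have : cvg G.
  apply: cauchy_cvg; apply: cauchy_exP => e e0.
  (* Two points with error [c * e / 3] differ by at most [2 * c * e / 3] in [ynorm Y], hence by less
     than [e] in norm. *)
  have e1 : 0 < c * e / 3 by rewrite divr_gt0 ?mulr_gt0.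
  have [w Bw] := approx _ e1; exists w; exists (c * e / 3) => // v Bv.
  rewrite -ball_normE /= -(ltr_pM2l c0).
  apply: (@le_lt_trans _ _ (c * e / 3 + c * e / 3)); last first.
    by have := mulr_gt0 c0 e0; lra.
  apply: le_trans (proj1 (cY _)) _; apply: ynorm_le => // f Yf f1.
  have df := dsubspace_dual Y f sY Yf.
  rewrite dualB// (le_trans (ler_norm _))//.
  have -> : f w - f v = (f w - phi f) - (f v - phi f) by ring.
  apply: le_trans (ler_normB _ _) _.
  by apply: lerD; [apply: le_trans (Bw f Yf) _|apply: le_trans (Bv f Yf) _];
    rewrite -[leRHS]mulr1 ler_wpM2l// ltW.
move=> /cvg_ex[x0 Gx0]; exists x0 => f Yf.
have df := dsubspace_dual Y f sY Yf.
apply/eqP; rewrite -subr_eq0 -normr_le0; apply/ler_addgt0Pr => e e0.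
rewrite add0r; pose d := e / (2 * (dnorm f + 1)).
have D0 := dnorm_ge0 f df.
have d0 : 0 < d by rewrite divr_gt0// mulr_gt0// ltr_wpDl.
have dD : d * dnorm f <= e / 2.
  rewrite /d mulrAC ler_pdivrMr ?mulr_gt0// ?ltr_wpDl//.
  have -> : e / 2 * (2 * (dnorm f + 1)) = e * (dnorm f + 1) by field.
  by rewrite ler_wpM2l ?(ltW e0)// lerDl.
have GB : G (B d) by exists d.
have Gb : G (ball x0 d) by apply: Gx0; exact: nbhsx_ballx.
have [w [Bw]] := filter_ex (filterI GB Gb).
rewrite -ball_normE /= => x0w.
have -> : f x0 - phi f = f (x0 - w) + (f w - phi f) by rewrite (dualB f _ _ df); ring.
apply: le_trans (ler_normD _ _) _; rewrite [leRHS]splitr.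
apply: lerD; last exact: le_trans (Bw f Yf) dD.
apply: le_trans (le_dnorm _ _ df) _; apply: le_trans dD.
by rewrite mulrC ler_wpM2r// ltW.
Qed.

(** Some [x] is almost annihilated by the kernel, relative to its norm. As [f - phi f * u] lies in
    the kernel, [f x] is nearly [phi f * u x] for all [f] in [Y]. Since [Y] is norming, [u x] cannot
    be small, and [x / u x] nearly represents [phi]. *)
Lemma kernel_not_norming Y (phi : (X -> R) -> R) (M : R) (u : X -> R) :
  dsubspace Y -> norming Y ->
  (forall f g a b, Y f -> Y g ->
    phi (fun x => a * f x + b * g x) = a * phi f + b * phi g) ->
  0 <= M -> (forall f, Y f -> `|phi f| <= M * dnorm f) ->
  Y u -> phi u = 1 ->
  dsubspace [set f | Y f /\ phi f = 0] ->
  ~ norming [set f | Y f /\ phi f = 0] ->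
  forall e : R, 0 < e -> exists w, forall f, Y f ->
    `|f w - phi f| <= e * dnorm f.
Proof.
move=> sY [c [C [c0 [_ cY]]]] philin M0 phiM Yu phiu sZ nZ e e0.
set Z := [set f | _] in sZ nZ.
have du := dsubspace_dual Y u sY Yu.
have u0 := dnorm_ge0 u du.
pose k := 1 + M * dnorm u.
have k0 : 0 < k by rewrite ltr_pwDl// mulr_ge0.
have key f x : Y f -> `|f x - phi f * u x| <= k * dnorm f * ynorm Z x.
  move=> Yf; have df := dsubspace_dual Y f sY Yf.
  have Zg : Z (fun x => 1 * f x + (- phi f) * u x).
    split; first exact: dsubspace_comb.
    by rewrite philin// phiu; ring.
  have := le_ynorm Z _ x sZ Zg; rewrite mul1r mulNr => /le_trans; apply.
  rewrite mulrC ler_wpM2r//.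
    exact: ynorm_ge0.
  apply: dnorm_le => [|y]; first by rewrite mulr_ge0 ?(ltW k0) ?dnorm_ge0.
  rewrite mul1r mulNr; apply: le_trans (ler_normB _ _) _.
  rewrite /k normrM mulrDl mul1r mulrDl lerD ?le_dnorm//.
  apply: le_trans (ler_pM _ _ (phiM f Yf) (le_dnorm u y du)) _ => //.
  by rewrite mulrA [M * _ * _]mulrAC.
have M1 : 0 < M + 1 by rewrite ltr_wpDl.
(* The first bound keeps [M * |u x|] above [c / 4 * |x|]; the second makes the error at most
   [e * |u x|]. [M + 1] allows for [M = 0]. *)
pose d := Num.min (c / (4 * k)) (e * c / (4 * k * (M + 1))).
have d0 : 0 < d by rewrite lt_min !divr_gt0 ?mulr_gt0.
have [x xd] : exists x, ynorm Z x < d * `|x|.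
  apply: contrapT => nx; apply: nZ; apply: (normingI _ d) => // x.
  by rewrite leNgt; apply/negP => xd; apply: nx; exists x.
have x0 : 0 < `|x|.
  by rewrite -(pmulr_rgt0 _ d0); apply: le_lt_trans xd; exact: ynorm_ge0.
have kd1 : k * (d * `|x|) <= c / 4 * `|x|.
  have : d <= c / (4 * k) by rewrite ge_min lexx.
  rewrite ler_pdivlMr ?mulr_gt0// => h.
  by have := ler_wpM2r (ltW x0) h; lra.
have kd2 : k * (d * `|x|) * (M + 1) <= e * (c / 4 * `|x|).
  have : d <= e * c / (4 * k * (M + 1)) by rewrite ge_min lexx orbT.
  rewrite ler_pdivlMr ?mulr_gt0// => h.
  by have := ler_wpM2r (ltW x0) h; lra.
have [f [Yf f1 fx]] : exists f, [/\ Y f, dnorm f <= 1 & c / 2 * `|x| < f x].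
  apply: ynorm_adherent => //; apply: lt_le_trans (proj1 (cY x)).
  by rewrite ltr_pM2r// ltr_pdivrMr// ltr_pMr// ltr1n.
have cux : c / 4 * `|x| <= M * `|u x|.
  have kf : k * dnorm f * ynorm Z x <= k * (d * `|x|).
    rewrite -mulrA ler_wpM2l ?(ltW k0)// -[leRHS]mul1r.
    by apply: ler_pM => //; [exact: dnorm_ge0 (dsubspace_dual Y f sY Yf)|exact: ynorm_ge0|exact: ltW].
  have h1 := le_trans (key f x Yf) kf.
  have h2 : `|phi f * u x| <= M * `|u x|.
    rewrite normrM ler_wpM2r//; apply: le_trans (phiM f Yf) _.
    by rewrite -[leRHS]mulr1 ler_wpM2l.
  have := ler_norm (f x - phi f * u x); have := ler_norm (phi f * u x).
  by lra.
have ux0 : 0 < `|u x|.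
  rewrite normr_gt0; apply/eqP => ux; move: cux.
  by rewrite ux normr0 mulr0 leNgt mulr_gt0 ?divr_gt0.
have kdu : k * (d * `|x|) <= e * `|u x|.
  rewrite -(ler_pM2r M1); apply: le_trans kd2 _; rewrite -[leRHS]mulrA ler_wpM2l ?(ltW e0)//.
  by apply: le_trans cux _; rewrite mulrDr mulr1 mulrC lerDl.
exists ((u x)^-1 *: x) => g Yg; have dg := dsubspace_dual Y g sY Yg.
have un0 : u x != 0 by rewrite -normr_gt0.
have -> : g ((u x)^-1 *: x) - phi g = (u x)^-1 * (g x - phi g * u x).
  by rewrite dualZ//; field.
rewrite normrM normfV ler_pdivrMl//.
apply: le_trans (key g x Yg) _.
rewrite mulrAC [leRHS]mulrA ler_wpM2r ?dnorm_ge0// [_ * e]mulrC.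
by apply: le_trans kdu; rewrite ler_wpM2l ?(ltW k0)// ltW.
Qed.

End KernelNorming.

(** * The sum of a subspace and a line, and its coordinate functional *)

Section LineSum.
Context {R : realType} {X : normedModType R}.
Implicit Types (f g h : X -> R) (x y : X) (K Y : set (X -> R)).

Definition line_sum Y (xs : X -> R) : set (X -> R) :=
  [set f | exists2 g, Y g & exists t : R, f = (fun x => g x + t * xs x)].

Lemma sub_line_sum Y xs : Y `<=` line_sum Y xs.
Proof.
move=> g Yg; exists g => //; exists 0.
by apply/funext => x; rewrite mul0r addr0.
Qed.

Lemma line_sum_line Y xs t : dsubspace Y -> line_sum Y xs (fun x => t * xs x).
Proof.
move=> sY; exists (fun=> 0); first exact: dsubspace0.
by exists t; apply/funext => x; rewrite add0r.
Qed.

Lemma line_sum_dsubspace Y xs : dsubspace Y -> dual xs ->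
  dsubspace (line_sum Y xs).
Proof.
move=> sY dxs; split; last split; last split.
- move=> _ [g Yg [t ->]].
  have := dual_comb g xs 1 t (dsubspace_dual Y g sY Yg) dxs.
  by under eq_fun do rewrite mul1r.
- by apply: sub_line_sum; exact: dsubspace0.
- move=> _ _ [g Yg [t ->]] [h Yh [s ->]].
  exists (fun x => g x + 1 * h x); first exact: dsubspaceDZ.
  by exists (t + s); apply/funext => x; ring.
- move=> a _ [g Yg [t ->]]; exists (fun x => a * g x); first exact: dsubspaceZ.
  by exists (a * t); apply/funext => x; ring.
Qed.

(** [xs] has positive distance [d] from the closed subspace [Y], and [g + t xs] is [t] times a
    difference of [xs] and a point of [Y]. *)
Lemma line_coord_bounded Y xs : dsubspace Y -> dnorm_closed Y -> dual xs ->
  ~ Y xs -> exists2 d : R, 0 < d & forall g t (N : R), Y g -> 0 <= N ->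
    (forall x, `|g x + t * xs x| <= N * `|x|) -> `|t| * d <= N.
Proof.
move=> sY cY dxs nY.
have [d d0 dP] : exists2 d : R, 0 < d &
    forall g, Y g -> d <= dnorm (fun x => xs x - g x).
  apply: contrapT => nd; apply: nY; apply: cY => // e e0.
  apply: contrapT => ne; apply: nd; exists e => // g Yg.
  by rewrite leNgt; apply/negP => ge; apply: ne; exists g.
exists d => // g t N Yg N0 gN.
have [->|t0] := eqVneq t 0; first by rewrite normr0 mul0r.
have nt : 0 < `|t| by rewrite normr_gt0.
rewrite mulrC -ler_pdivlMr//.
apply: le_trans (dP (fun x => - t^-1 * g x) (dsubspaceZ Y g _ sY Yg)) _.
apply: dnorm_le => [|x]; first by rewrite divr_ge0.
have -> : xs x - - t^-1 * g x = t^-1 * (g x + t * xs x) by field.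
rewrite normrM normfV ler_pdivrMl//.
have -> : `|t| * (N / `|t| * `|x|) = N * `|x| by field; rewrite gt_eqF.
exact: gN.
Qed.

(** By [line_coord_bounded] the coordinates of approximants of [f] form a Cauchy filter. With [t]
    its limit, [f - t xs] is a norm limit of points of [Y]. *)
Lemma line_sum_closed Y xs : dsubspace Y -> dnorm_closed Y -> dual xs ->
  ~ Y xs -> dnorm_closed (line_sum Y xs).
Proof.
move=> sY cY dxs nY f df fa.
have [d d0 dP] := line_coord_bounded Y xs sY cY dxs nY.
pose B (e : R) := [set t | exists2 g, Y g &
  forall x, `|f x - (g x + t * xs x)| <= e * `|x|].
pose G := filter_from [set e : R | 0 < e] B.
have PG : ProperFilter G.
  apply: filter_from_proper; last first.
    move=> e /= e0; have [_ [g Yg [t ->]] ft] := fa e e0.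
    exists t, g => // x; have dg := dsubspace_dual Y g sY Yg.
    have dgt : dual (fun x => g x + t * xs x).
      have := dual_comb g xs 1 t dg dxs.
      by under eq_fun do rewrite mul1r.
    apply: le_trans (dnorm_dist _ _ x df dgt) _.
    by rewrite ler_wpM2r// ltW.
  apply: filter_from_filter; first by exists 1; exact: ltr01.
  move=> a b a0 b0; exists (Num.min a b); first by rewrite /= lt_min a0 b0.
  move=> t [g Yg gt]; split; exists g => // x; apply: le_trans (gt x) _;
    by rewrite ler_wpM2r// ge_min lexx ?orbT.
have : cvg G.
  apply: cauchy_cvg; apply: cauchy_exP => e e0.
  have e1 : 0 < d * e / 3 by rewrite divr_gt0 ?mulr_gt0.
  have GB : G (B (d * e / 3)) by exists (d * e / 3).
  have [t Bt] := filter_ex GB; exists t; apply: filterS GB => s Bs.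
  rewrite -ball_normE /=; case: Bt => g Yg gt; case: Bs => h Yh hs.
  rewrite -(ltr_pM2r d0).
  apply: (@le_lt_trans _ _ (2 * (d * e / 3))).
    apply: (dP (fun x => g x + (-1) * h x)); first exact: dsubspaceDZ.
      by rewrite mulr_ge0// ltW.
    move=> x; have -> : g x + -1 * h x + (t - s) * xs x =
      (f x - (h x + s * xs x)) - (f x - (g x + t * xs x)) by ring.
    apply: le_trans (ler_normB _ _) _.
    by have := hs x; have := gt x; lra.
  by have := mulr_gt0 d0 e0; lra.
move=> /cvg_ex[/= t Gt].
exists (fun x => f x - t * xs x); last first.
  by exists t; apply/funext => x; ring.
have dft : dual (fun x => f x - t * xs x).
  have := dual_comb f xs 1 (- t) df dxs.
  by under eq_fun do rewrite mul1r mulNr.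
apply: cY => // e e0.
have N0 := dnorm_ge0 xs dxs.
pose a := e / (2 * (dnorm xs + 2)).
have a0 : 0 < a by rewrite divr_gt0// mulr_gt0// ltr_wpDl.
have Gb : G (ball t a) by apply: Gt; exact: nbhsx_ballx.
have GB : G (B a) by exists a.
have [s [[g Yg gs]]] := filter_ex (filterI GB Gb).
rewrite -ball_normE /= => ts; exists g => //.
apply: (@le_lt_trans _ _ (a + a * dnorm xs)); last first.
  have -> : a + a * dnorm xs = e / 2 * ((1 + dnorm xs) / (dnorm xs + 2)).
    by rewrite /a; field; rewrite gt_eqF// ltr_wpDl.
  apply: (@le_lt_trans _ _ (e / 2 * 1)); last by lra.
  rewrite ler_wpM2l ?divr_ge0 ?(ltW e0)// ler_pdivrMr ?ltr_wpDl//; lra.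
apply: dnorm_le => [|x]; first by rewrite ltW// ltr_wpDr// mulr_ge0// ltW.
have -> : f x - t * xs x - g x =
  (f x - (g x + s * xs x)) - (t - s) * xs x by ring.
apply: le_trans (ler_normB _ _) _; rewrite [leRHS]mulrDl lerD// normrM -mulrA.
by apply: ler_pM => //; [exact: ltW|exact: le_dnorm].
Qed.

(** For negative [B] and [l <= - B / (C + 1)] the linear term outweighs the quadratic one. This
    yields the first-order condition at a minimizer. *)
Lemma quadratic_ge0_linear (B C l0 : R) : 0 < l0 -> 0 <= C ->
  (forall l, 0 < l -> l <= l0 -> 0 <= 2 * l * B + l ^+ 2 * C) -> 0 <= B.
Proof.
move=> l00 C0 H; rewrite leNgt; apply/negP => B0.
have C1 : 0 < C + 1 by rewrite ltr_wpDl.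
pose l := Num.min l0 (- B / (C + 1)).
have l1 : 0 < l by rewrite lt_min l00 divr_gt0// oppr_gt0.
have := H l l1; rewrite ge_min lexx => /(_ isT).
have -> : 2 * l * B + l ^+ 2 * C = l * (2 * B + l * C) by ring.
rewrite pmulr_rge0//.
have : l <= - B / (C + 1) by rewrite ge_min lexx orbT.
rewrite ler_pdivlMr// => h.
by lra.
Qed.

(* The functional [g + t xs |-> t] is separated from the evaluations by
   minimizing the distance to [(0, e)] in finitely many coordinates of the graph
   of its restriction to [K]; truncating that graph at [|t| <= 3 e] makes
   it compact and leaves the minimizer in the interior. *)
Lemma line_coord_approx Y xs K (e : R) : dsubspace Y -> dual xs -> ~ Y xs ->
  acwc K -> K (fun=> 0) -> 0 < e ->
  closed (([set h | exists f g, [/\ K f,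
      [set g | exists2 t : R, `|t| <= 1 & g = (fun x => t * xs x)] g &
      h = (fun x => 1 * f x + (3 * e) * g x)]] `&` Y) : set {ptws X -> R}) ->
  exists x, forall g t, Y g -> K (fun x => g x + t * xs x) ->
    `|t - (g x + t * xs x)| <= e.
Proof.
move=> sY dxs nY aK K0 e0; set S := [set h | _] => cL.
have e3 : 0 < 3 * e by rewrite mulr_gt0.
have aS : acwc S by apply: acwc_comb => //; exact: acwc_segment.
(* The compact set [S] meeting [Y] thus holds all [Y]-components of the truncated graph. *)
have inL h t : Y h -> `|t| <= 3 * e -> K (fun x => h x + t * xs x) ->
    (S `&` Y) h.
  move=> Yh te Kh; split=> //; exists (fun x => h x + t * xs x).
  exists (fun x => - t / (3 * e) * xs x); split => //.
    exists (- t / (3 * e)) => //.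
    by rewrite normrM normrN normfV (gtr0_norm e3) ler_pdivrMr// mul1r.
  by apply/funext => x; field; rewrite gt_eqF.
have cptL : compact ((S `&` Y) : set {ptws X -> R}).
  have -> : S `&` Y = S `&` (S `&` Y) by rewrite setIA setIid.
  by apply: compact_closedI => //; case: aS => _ [].
have cK := acwc_closed K aK.
pose P1 := [set h : {ptws X -> R} |
  (S `&` Y) h /\ K (fun x => h x + e * xs x)].
have cptP1 : compact P1.
  pose m (h : {ptws X -> R}) : {ptws X -> R} := fun x => h x + e * xs x.
  have mc : continuous m.
    apply: ptws_continuous => x; apply: continuous_addf.
      exact: eval_continuous.
    exact: cst_continuous.
  by apply: (compact_closedI cptL); exact: (@closed_comp _ _ m K).
pose P := [set p : {ptws X -> R} * R |
  ((S `&` Y) p.1 /\ `|p.2| <= 3 * e) /\ K (fun x => p.1 x + p.2 * xs x)].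
have cptP : compact P.
  pose m (p : {ptws X -> R} * R) : {ptws X -> R} := fun x => p.1 x + p.2 * xs x.
  have mc : continuous m.
    apply: ptws_continuous => x; apply: continuous_addf.
      exact: eval_fst_continuous.
    by apply: continuous_mulr => p; exact: cvg_snd.
  have -> : P = ((S `&` Y : set {ptws X -> R}) `*` `[(- (3 * e)), (3 * e)]%classic)
      `&` m @^-1` K.
    by apply/seteqP; split=> [[h t] /=|[h t] /=]; rewrite in_itv /= -ler_norml.
  apply: compact_closedI.
    by apply: compact_setX => //; exact: segment_compact.
  exact: (@closed_comp _ _ m K).
(* On the slice [t = e] the functional [h + e xs] never vanishes, as [xs] is outside [Y]. By
   compactness, finitely many points detect this; [G] is the filter of finite lists growing by
   inclusion. *)
have [D Dcov] : exists D : seq X, forall h, P1 h ->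
    exists2 x, x \in D & h x + e * xs x != 0.
  pose G := filter_from [set: seq X] (fun D => [set D' : seq X | {subset D <= D'}]).
  have FG : Filter G.
    apply: filter_from_filter; first by exists [::].
    move=> D D' _ _; exists (D ++ D') => // D'' sD.
    by split=> x xD; apply: sD; rewrite mem_cat xD ?orbT.
  have := proj1 (compact_near_coveringP P1) cptP1 (seq X) G
    (fun D h => exists2 x, x \in D & h x + e * xs x != 0) FG.
  case=> [h [[_ Yh] Kh]|D _ DP]; last by exists D => h; exact: (DP D).
  have [x hx] : exists x, h x + e * xs x != 0.
    apply: contrapT => nh; apply: nY.
    have -> : xs = (fun x => - e^-1 * h x); last exact: dsubspaceZ.
    apply/funext => x; have : h x + e * xs x = 0.
      by apply/eqP; rewrite -[_ == _]negbK; apply/negP => hx; apply: nh; exists x.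
    by move/eqP; rewrite addr_eq0 => /eqP ->; field; rewrite gt_eqF.
  exists ([set g : {ptws X -> R} | g x + e * xs x != 0], [set D : seq X | {subset [:: x] <= D}]).
    split; last by exists [:: x].
    have ec : continuous (fun g : {ptws X -> R} => g x + e * xs x).
      apply: continuous_addf; first exact: eval_continuous.
      exact: cst_continuous.
    have oc : open [set g : {ptws X -> R} | g x + e * xs x != 0].
      apply: (@open_comp _ _ (fun g : {ptws X -> R} => g x + e * xs x)
        [set r : R | r != 0]).
        by move=> g _; exact: ec.
      exact: open_neq.
    exact: open_nbhs_nbhs.
  move=> [g D] [/= gx xD]; exists x => //; apply: xD; exact: mem_head.
pose q (p : {ptws X -> R} * R) : R :=
  \sum_(x <- D) (p.1 x + p.2 * xs x) ^+ 2 + (p.2 - e) ^+ 2.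
have qc : continuous q.
  have sqc (u : {ptws X -> R} * R -> R) :
      continuous u -> continuous (fun p => u p ^+ 2).
    by move=> uc; exact: (continuous_mulf _ u u).
  have sndc : continuous (fun p : {ptws X -> R} * R => p.2).
    by move=> p; exact: cvg_snd.
  apply: continuous_addf; last first.
    apply: sqc; apply: continuous_addf => //; exact: cst_continuous.
  apply: continuous_sumr => x; apply: sqc; apply: continuous_addf.
    exact: eval_fst_continuous.
  exact: continuous_mulr.
have P00 : P (fun=> 0, 0).
  split=> /=; last by under eq_fun do rewrite mul0r addr0.
  split; last by rewrite normr0 ltW.
  apply: (inL _ 0); [exact: dsubspace0|by rewrite normr0 ltW|].
  by under eq_fun do rewrite mul0r addr0.
have [[h0 t0]] := @compact_EVT_min _ R q P (ex_intro _ _ P00) cptP (continuous_subspaceT qc).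
rewrite inE => -[[/= [_ Yh0] t0e] Kh0] qmin.
pose a x := h0 x + t0 * xs x.
pose sa := \sum_(x <- D) a x ^+ 2.
have qE : q (h0, t0) = sa + (t0 - e) ^+ 2 by [].
have sa0 : 0 <= sa by apply: sumr_ge0 => x _; exact: sqr_ge0.
(* A zero minimum would put the minimizer on the slice [t = e] with all coordinates in [D] equal to
   0, against the choice of [D]. *)
have q0 : 0 < sa + (t0 - e) ^+ 2.
  rewrite lt_neqAle addr_ge0 ?sqr_ge0// andbT eq_sym; apply/eqP => /eqP.
  rewrite paddr_eq0 ?sqr_ge0// sqrf_eq0 subr_eq0 => /andP[/eqP sa_eq0 /eqP te].
  rewrite te in Kh0 t0e.
  have /Dcov[x /= xD] : P1 h0 by split; [exact: (inL h0 e)|].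
  apply/negP; rewrite negbK -te -sqrf_eq0.
  move: sa_eq0; rewrite /sa => /eqP; rewrite psumr_eq0 => [|i _]; last exact: sqr_ge0.
  by move=> /allP/(_ x xD).
(* Comparison with the origin of the graph; it confines [t0] to [[0, 2 e]], at distance at least [e]
   from the truncation. *)
have qe : sa + (t0 - e) ^+ 2 <= e ^+ 2.
  have := qmin (fun=> 0, 0); rewrite inE => /(_ P00); rewrite qE => /le_trans; apply.
  rewrite /q /= big1 => [|x _]; last by rewrite mul0r addr0 expr0n.
  by rewrite add0r sub0r sqrrN.
have t0_ge0 : 0 <= t0 by nra.
have t0_le : t0 <= 2 * e by nra.
(* First-order condition at the minimizer in the direction of any point of the graph, even beyond
   the truncation: a step of length [l <= l0] moves [t0] by at most [e]. *)
have var g t : Y g -> K (fun x => g x + t * xs x) ->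
    sa + (t0 - e) * t0 <=
    \sum_(x <- D) a x * (g x + t * xs x) + (t0 - e) * t.
  move=> Yg Kg; pose b x := g x + t * xs x.
  pose B := \sum_(x <- D) a x * (b x - a x) + (t0 - e) * (t - t0).
  pose C := \sum_(x <- D) (b x - a x) ^+ 2 + (t - t0) ^+ 2.
  have BE : B = \sum_(x <- D) a x * b x + (t0 - e) * t - (sa + (t0 - e) * t0).
    rewrite /B /sa; have -> : \sum_(x <- D) a x * (b x - a x) =
      \sum_(x <- D) a x * b x - \sum_(x <- D) a x ^+ 2; last by ring.
    by rewrite -sumrB; apply: eq_bigr => x _; ring.
  rewrite -subr_ge0 -BE.
  pose l0 := e / (e + `|t - t0|).
  have n0 : 0 < e + `|t - t0| by rewrite ltr_pwDl.
  apply: (quadratic_ge0_linear B C l0); first exact: divr_gt0.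
    by rewrite addr_ge0 ?sqr_ge0// sumr_ge0// => x _; exact: sqr_ge0.
  move=> l lp ll0.
  have l1 : l <= 1 by apply: le_trans ll0 _; rewrite ler_pdivrMr// mul1r lerDl.
  have lt_e : l * `|t - t0| <= e.
    move: ll0; rewrite ler_pdivlMr// mulrDr; have := mulr_gt0 lp e0; lra.
  pose h x := (1 - l) * h0 x + l * g x.
  pose s := (1 - l) * t0 + l * t.
  have Yh : Y h by exact: dsubspace_comb.
  have hE x : h x + s * xs x = (1 - l) * a x + l * b x by rewrite /h /s /a /b; ring.
  have Kh : K (fun x => h x + s * xs x).
    under eq_fun do rewrite hE.
    case: aK => _ [cvxK _]; apply: cvxK => //.
    by rewrite ger0_norm ?subr_ge0// gtr0_norm// subrK.
  have se : `|s| <= 3 * e.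
    have -> : s = t0 + l * (t - t0) by rewrite /s; ring.
    apply: le_trans (ler_normD _ _) _; rewrite normrM (gtr0_norm lp) (ger0_norm t0_ge0).
    lra.
  have Phs : P (h, s) by split => //; split => //; exact: (inL h s).
  have := qmin (h, s); rewrite inE => /(_ Phs).
  have -> : q (h, s) = q (h0, t0) + (2 * l * B + l ^+ 2 * C); last by rewrite lerDl.
  rewrite qE /q /=.
  have -> : \sum_(x <- D) (h x + s * xs x) ^+ 2 =
      sa + (2 * l * (\sum_(x <- D) a x * (b x - a x)) +
      l ^+ 2 * \sum_(x <- D) (b x - a x) ^+ 2).
    rewrite !mulr_sumr -!big_split /=; apply: eq_bigr => x _; rewrite hE; ring.
  rewrite /B /C /s; ring.
(* At the origin the condition reads [sa + (t0 - e) * t0 <= 0], so [t0 >= e] would make the minimum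
   zero. *)
have s0 : t0 - e < 0.
  have := var (fun=> 0) 0 (dsubspace0 Y sY).
  under eq_fun do rewrite mul0r addr0.
  move=> /(_ K0); rewrite big1 => [|x _]; last by rewrite mul0r addr0 mulr0.
  rewrite mulr0 addr0; nra.
pose v := \sum_(x <- D) a x *: x.
(* [v] and [t0 - e] are the coefficients of the separating hyperplane; dividing by [e - t0]
   normalizes the coefficient of [t]. *)
exists ((e - t0)^-1 *: v) => g t Yg Kg.
have [dg dx] := (dsubspace_dual Y g sY Yg, dxs).
have fv : g v + t * xs v = \sum_(x <- D) a x * (g x + t * xs x).
  rewrite /v !(dual_sum _ _ _ _ (fun x => x))// mulr_sumr -big_split /=.
  by apply: eq_bigr => x _; ring.
have v1 := var g t Yg Kg.
(* [K] is symmetric, so the condition also holds at [(- g, - t)]. *)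
have v2 : sa + (t0 - e) * t0 <= - (g v + t * xs v) - (t0 - e) * t.
  have := var (fun x => -1 * g x) (- t) (dsubspaceZ Y g (-1) sY Yg).
  have -> : (fun x => -1 * g x + - t * xs x) = (fun x => -1 * (g x + t * xs x)).
    by apply/funext => x; ring.
  case: (aK) => _ [cvxK _].
  move=> /(_ (abs_convexZ K _ (-1) cvxK Kg _)); rewrite normrN normr1 => /(_ (lexx _)).
  rewrite fv mulrN; congr (_ <= _ + _); rewrite -sumrN; apply: eq_bigr => x _; ring.
rewrite -fv in v1.
have es : 0 < e - t0 by lra.
rewrite (dualZ g _ v dg) (dualZ xs _ v dx).
have -> : t - ((e - t0)^-1 * g v + t * ((e - t0)^-1 * xs v)) =
   (t * (e - t0) - (g v + t * xs v)) / (e - t0) by field; rewrite gt_eqF.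
rewrite normrM normfV (gtr0_norm es) ler_pdivrMr// ler_norml.
(* Both conditions bound the error by [(e - t0) * t0], which falls short of [e * (e - t0)] by this
   square. *)
have sq := sqr_ge0 (e - t0); set V := g v + t * xs v in v1 v2 *.
by apply/andP; split; lra.
Qed.

End LineSum.

(** * The two implications between completeness and the closure condition *)

Section Completeness.
Context {R : realType} {X : completeNormedModType R}.
Implicit Types (f g h : X -> R) (x y : X) (K Y : set (X -> R)).

Lemma mackey_complete_of_closures Y :
  (forall Z : set (X -> R), dsubspace Z -> norming Z -> dnorm_closed Z ->
   forall xs, dual xs -> ~ Z xs -> exists K,
     [/\ acwc K, K `<=` line_sum Z xs &
         closure ((K `&` Z) : set {ptws X -> R}) xs]) ->
  dsubspace Y -> norming Y -> dnorm_closed Y -> mackey_complete Y.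
Proof.
move=> H sY nY cY F FF cF.
have [phi [philin phiF]] := mackey_limit Y F sY FF cF.
have [M M0 phiM] := mackey_limit_bounded Y F phi sY cY FF philin phiF.
suff [x0 x0P] : exists x0, forall f, Y f -> f x0 = phi f.
  exists x0 => K aK KY e e0.
  have e2 : 0 < e / 2 by rewrite divr_gt0.
  have [A FA Ae] := phiF K aK KY _ e2; exists A => // x Ax f Kf.
  rewrite x0P; last exact: KY.
  by apply: le_lt_trans (Ae x Ax f Kf) _; rewrite ltr_pdivrMr// ltr_pMr// ltr1n.
have phiZ a f : Y f -> phi (fun x => a * f x) = a * phi f.
  move=> Yf; have := philin f f a 0 Yf Yf; rewrite mul0r addr0 => <-.
  by congr phi; apply/funext => x; rewrite mul0r addr0.
have [[v [Yv phiv]]|phi0] := pselect (exists v, Y v /\ phi v <> 0); last first.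
  exists 0 => f Yf; rewrite (dual0P f (dsubspace_dual Y f sY Yf)).
  by apply/esym; apply: contrapT => pf; apply: phi0; exists f.
pose u := fun x => (phi v)^-1 * v x.
have Yu : Y u by exact: dsubspaceZ.
have phiu : phi u = 1 by rewrite phiZ// mulVf//; apply/eqP.
pose Z := [set f | Y f /\ phi f = 0].
have phi00 : phi (fun=> 0) = 0.
  have -> : (fun=> 0) = (fun x => 0 * u x) by apply/funext => x; rewrite mul0r.
  by rewrite phiZ// mul0r.
have sZ : dsubspace Z.
  split; first by move=> f [Yf _]; exact: dsubspace_dual sY Yf.
  split; first by split; [exact: dsubspace0|].
  split=> [f g [Yf f0] [Yg g0]|a f [Yf f0]].
    have -> : (fun x => f x + g x) = (fun x => 1 * f x + 1 * g x).
      by apply/funext => x; rewrite !mul1r.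
    split; first exact: dsubspace_comb.
    by rewrite philin// f0 g0; ring.
  by split; [exact: dsubspaceZ|rewrite phiZ// f0 mulr0].
(* The kernel is closed because [phi] is norm bounded on the closed subspace [Y]. *)
have cZ : dnorm_closed Z.
  move=> f df fa.
  have Yf : Y f by apply: cY => // e /(fa e)[g [Yg _] fg]; exists g.
  split=> //; apply/normr0_eq0/eqP; rewrite eq_le normr_ge0 andbT.
  apply/ler_addgt0Pr => e e0; rewrite add0r.
  have M1 : 0 < M + 1 by rewrite ltr_wpDl.
  have [g [Yg g0] fg] := fa (e / (M + 1)) (divr_gt0 e0 M1).
  have fgE : (fun x => f x - g x) = (fun x => 1 * f x + (-1) * g x).
    by apply/funext => x; ring.
  have Yfg : Y (fun x => f x - g x) by rewrite fgE; exact: dsubspace_comb.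
  have <- : phi (fun x => f x - g x) = phi f by rewrite fgE philin// g0; ring.
  apply: le_trans (phiM _ Yfg) _.
  apply: (@le_trans _ _ (M * (e / (M + 1)))); first by rewrite ler_wpM2l// ltW.
  by rewrite mulrA ler_pdivrMr// mulrC ler_wpM2l ?(ltW e0)// lerDl.
have [nZ|nZ] := pselect (norming Z); last first.
  apply: (approx_eval Y phi sY nY) => e e0.
  exact: (kernel_not_norming Y phi M u sY nY philin M0 phiM Yu phiu sZ nZ).
have du := dsubspace_dual Y u sY Yu.
have [|K [aK KZ clu]] := H Z sZ nZ cZ u du.
  by move=> [_]; rewrite phiu => /eqP; rewrite oner_eq0.
have KY : K `<=` Y.
  by move=> f /KZ[g [Yg _] [t ->]]; exact: dsubspaceDZ.
have Ku : K u.
  have /closure_id -> := acwc_closed K aK.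
  by apply: closure_subset clu; exact: subIsetl.
have e4 : 0 < 4^-1 :> R by rewrite invr_gt0.
have [A FA Ae] := phiF K aK KY _ e4; have [x Ax] := filter_ex FA.
(* On [K] evaluation at [x] is within 1/4 of [phi], where [phi u = 1] and [phi g = 0]. So [u x] and
   [g x] differ by at least 1/2, although [g] was picked with [g x] within 1/4 of [u x]. *)
have [g [[Kg [Yg g0]]] /=] : (K `&` Z) `&` [set g | `|u x - g x| < 4^-1] !=set0.
  apply: clu; have := @eval_continuous R X x u.
  by move/cvgrPdist_lt => /(_ _ e4).
have := Ae x Ax g Kg; rewrite g0 subr0.
have := Ae x Ax u Ku; rewrite phiu.
by rewrite !ler_norml ltr_norml => /andP[h1 h2] /andP[h3 h4] /andP[h5 h6]; lra.
Qed.

Lemma closure_of_mackey_complete Y xs :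
  dsubspace Y -> norming Y -> dual xs -> ~ Y xs ->
  mackey_complete (line_sum Y xs) ->
  exists K, [/\ acwc K, K `<=` line_sum Y xs &
                closure ((K `&` Y) : set {ptws X -> R}) xs].
Proof.
move=> sY nY dxs nYx mc; apply: contrapT => nK.
have sY' := line_sum_dsubspace Y xs sY dxs.
have clK K : acwc K -> K `<=` line_sum Y xs ->
    closed ((K `&` Y) : set {ptws X -> R}).
  move=> aK KY' z clz; apply: contrapT => nz.
  have Kz : K z.
    have /closure_id -> := acwc_closed K aK.
    by apply: closure_subset clz; exact: subIsetl.
  have [y Yy [t zE]] := KY' z Kz.
  have t0 : t != 0.
    apply/eqP => t0; apply: nz; split => //; rewrite zE t0.
    by under eq_fun do rewrite mul0r addr0.
  apply: nK.
  exists [set h | exists f g, [/\ K f,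
      [set g | exists2 s : R, `|s| <= 1 & g = (fun x => s * y x)] g &
      h = (fun x => t^-1 * f x + t^-1 * g x)]].
  split.
  - by apply: acwc_comb => //; exact: acwc_segment (dsubspace_dual Y y sY Yy).
  - move=> _ [f [_ [Kf [s _ ->] ->]]]; apply: dsubspace_comb => //.
      exact: KY'.
    by apply: sub_line_sum; exact: dsubspaceZ.
  (* [m] sends [z = y + t xs] to [xs], preserves [Y] and maps [K] into the new set; by continuity it
     carries the closure point along. *)
  - pose m (f : {ptws X -> R}) : {ptws X -> R} := fun x => t^-1 * f x + t^-1 * (-1 * y x).
    have mc' : continuous m.
      apply: ptws_continuous => x; apply: continuous_addf; last exact: cst_continuous.
      apply: continuous_mulf; first exact: cst_continuous.
      exact: eval_continuous.
    have mz : m z = xs by apply/funext => x; rewrite /m zE; field.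
    rewrite -mz => B /(mc' z)/clz[f [[Kf Yf] Bf]]; exists (m f); split => //.
    split; last by apply: dsubspace_comb => //; exact: dsubspaceZ.
    exists f, (fun x => -1 * y x); split => //.
    by exists (-1) => //; rewrite normrN normr1.
(* [A (K, e)] gathers the points whose evaluation is within [e] of the coordinate [t] on [K]. These
   sets generate a filter [F] tending to the coordinate functional uniformly on each admissible
   [K]. *)
pose A (Ke : set (X -> R) * R) := [set x | forall g t, Y g ->
  Ke.1 (fun x => g x + t * xs x) -> `|t - (g x + t * xs x)| <= Ke.2].
pose D := [set Ke : set (X -> R) * R |
  [/\ acwc Ke.1, Ke.1 `<=` line_sum Y xs, Ke.1 (fun=> 0) & 0 < Ke.2]].
pose F := filter_from D A.
have seg_D f e : line_sum Y xs f -> 0 < e ->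
    D ([set g | exists2 t : R, `|t| <= 1 & g = (fun x => t * f x)], e).
  move=> Y'f e0; split => //=.
  - exact: acwc_segment (dsubspace_dual _ f sY' Y'f).
  - by move=> _ [t _ ->]; exact: dsubspaceZ.
  - by exists 0; [rewrite normr0|apply/funext => x; rewrite mul0r].
have FF : ProperFilter F.
  apply: filter_from_proper; last first.
    move=> [K e] [/= aK KY' K0 e0]; apply: (line_coord_approx Y xs K e) => //.
    apply: clK; first by apply: acwc_comb => //; exact: acwc_segment.
    move=> _ [f [_ [Kf [s _ ->] ->]]]; apply: dsubspace_comb => //.
      exact: KY'.
    exact: line_sum_line.
  apply: filter_from_filter.
    exists ([set g | exists2 t : R, `|t| <= 1 & g = (fun x => t * xs x)], 1).
    apply: seg_D => //; have := line_sum_line Y xs 1 sY.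
    by under eq_fun do rewrite mul1r.
  move=> [K e] [L d] [/= aK KY' K0 e0] [/= aL LY' L0 d0].
  (* The sum contains both [K] and [L] because each contains 0, so the base is directed. *)
  pose S := [set h | exists f g, [/\ K f, L g & h = (fun x => 1 * f x + 1 * g x)]].
  have KS : K `<=` S.
    by move=> f Kf; exists f, (fun=> 0); split => //; apply/funext => x; ring.
  have LS : L `<=` S.
    by move=> f Lf; exists (fun=> 0), f; split => //; apply/funext => x; ring.
  exists (S, Num.min e d).
    split => /=; [exact: acwc_comb| |exact: KS|by rewrite lt_min e0].
    move=> _ [f [g [Kf Lg ->]]]; apply: dsubspace_comb => //; [exact: KY'|exact: LY'].
  move=> x /= Sx; split=> g t Yg; [move=> /KS|move=> /LS] => /(Sx g t Yg) h;
    by apply: le_trans h _; rewrite ge_min lexx ?orbT.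
have cF : mackey_cauchy (line_sum Y xs) F.
  move=> K aK KY' e e0.
  have [[f Kf]|nKf] := pselect (K !=set0); last first.
    exists setT; first exact: filterT.
    by move=> x y _ _ f Kf; exfalso; apply: nKf; exists f.
  have K0 : K (fun=> 0) by apply: abs_convex0 Kf; case: aK => _ [].
  have e3 : 0 < e / 3 by rewrite divr_gt0.
  exists (A (K, e / 3)); first by exists (K, e / 3).
  move=> x y Ax Ay h Kh; have [g Yg [t hE]] := KY' h Kh.
  rewrite hE in Kh *.
  have /= := Ax g t Yg Kh; have /= := Ay g t Yg Kh.
  rewrite !ler_norml ltr_norml => /andP[h1 h2] /andP[h3 h4].
  by apply/andP; split; lra.
have [x0 Fx0] := mc F FF cF.
(* Convergence on the segment of [g + t xs] makes [x0] represent the coordinate functional. Then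
   [x0] is annihilated by the norming [Y], hence is 0, which fails at [t = 1]. *)
have x0P g t : Y g -> g x0 + t * xs x0 = t.
  move=> Yg; pose f x := g x + t * xs x.
  have Y'f : line_sum Y xs f by exists g => //; exists t.
  apply/eqP; rewrite -subr_eq0 -normr_le0; apply/ler_addgt0Pr => e e0.
  have e2 : 0 < e / 2 by rewrite divr_gt0.
  have [/= aS SY' _ _] := seg_D f (e / 2) Y'f e2.
  have fS : [set g | exists2 t : R, `|t| <= 1 & g = (fun x => t * f x)] f.
    by exists 1; [rewrite normr1|apply/funext => x; rewrite mul1r].
  have [B FB Be] := Fx0 _ aS SY' (e / 2) e2.
  have FA : F (A ([set g | exists2 t : R, `|t| <= 1 & g = (fun x => t * f x)], e / 2)).
    by exists ([set g | exists2 t : R, `|t| <= 1 & g = (fun x => t * f x)], e / 2);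
      first exact: seg_D.
  have [x [Bx /(_ g t Yg fS)/= Ax]] := filter_ex (filterI FB FA).
  move: Ax (Be x Bx f fS); rewrite /f.
  rewrite !ler_norml ltr_norml => /andP[h1 h2] /andP[h3 h4].
  by apply/andP; split; lra.
have x00 : x0 = 0.
  apply: (norming_eq0 Y x0 sY nY) => g Yg.
  by have := x0P g 0 Yg; rewrite mul0r addr0.
have := x0P (fun=> 0) 1 (dsubspace0 Y sY).
by rewrite x00 (dual0P xs dxs) mulr0 addr0 => /esym/eqP; rewrite oner_eq0.
Qed.

End Completeness.

Theorem theorem3p5 (R : realType) (X : completeNormedModType R) :
  fully_mackey_complete X <->
  (forall Y : set (X -> R), dsubspace Y -> norming Y -> dnorm_closed Y ->
   forall xs : X -> R, dual xs -> ~ Y xs ->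
   exists K : set (X -> R),
     acwc K /\
     (forall f, K f -> exists2 g, Y g & exists t : R, f = (fun x => g x + t * xs x)) /\
     closure ((K `&` Y) : set {ptws X -> R}) xs).
Proof.
split=> [mc Y sY nY cY xs dxs nYx|H Y].
  have sY' := line_sum_dsubspace Y xs sY dxs.
  have [|K [aK KY' clx]] := closure_of_mackey_complete Y xs sY nY dxs nYx.
    apply: mc => //; last exact: line_sum_closed.
    by apply: (norming_sub Y) => //; exact: sub_line_sum.
  by exists K.
apply: mackey_complete_of_closures => Z sZ nZ cZ xs dxs nZx.
by have [K [aK [KZ clx]]] := H Z sZ nZ cZ xs dxs nZx; exists K.
Qed.
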